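(* Let $X$ be a completely regular Hausdorff space and let $\mathcal{P}$ be an ideal of closed sets in $X$. The following three statements are equivalent: (1) $X$ is locally-$\mathcal{P}$; (2) $C_{\mathcal{P}}(X)$ is a free ideal of $C(X)$; (3) $C^{\mathcal{P}}_{\infty}(X)$ is a free ideal of $C^{\mathcal{P}}_{\infty}(X)+C^*(X)$.
   Context: $C(X)$ is the ring of all real-valued continuous functions on $X$ and $C^*(X)$ its subring of bounded functions; $Z(f)=\{x\in X: f(x)=0\}$. An ideal of closed sets in $X$ is a nonempty family $\mathcal{P}$ of closed subsets of $X$ such that (i) $A,B\in\mathcal{P}$ implies $A\cup B\in\mathcal{P}$, and (ii) $A\in\mathcal{P}$, $B\subseteq A$ with $B$ closed in $X$ implies $B\in\mathcal{P}$. Set $C_{\mathcal{P}}(X)=\{f\in C(X): \mathrm{cl}_X(X\setminus Z(f))\in\mathcal{P}\}$, which is an ideal of $C(X)$, and $C^{\mathcal{P}}_{\infty}(X)=\{f\in C(X): \{x\in X: |f(x)|\geq\epsilon\}\in\mathcal{P}\text{ for each }\epsilon>0\}$, which is a subring of $C(X)$ and an ideal of the ring $C^{\mathcal{P}}_{\infty}(X)+C^*(X)=\{f+g: f\in C^{\mathcal{P}}_{\infty}(X), g\in C^*(X)\}$. Ideals of rings are not required to be proper. $X$ is locally-$\mathcal{P}$ if each point of $X$ has an open neighbourhood whose closure in $X$ belongs to $\mathcal{P}$. An ideal $I$ of a ring of real-valued functions on $X$ is free if $\bigcap_{f\in I}Z(f)=\emptyset$. *)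

(* Defs.v *)
From HB Require Import structures.
From mathcomp Require Import all_boot all_order all_algebra.
From mathcomp Require Import all_classical all_reals all_analysis.
Import Order.TTheory GRing.Theory Num.Theory.
Import numFieldNormedType.Exports.

Set Implicit Arguments.
Unset Strict Implicit.
Unset Printing Implicit Defensive.

Local Open Scope classical_set_scope.
Local Open Scope ring_scope.

(* Rings of functions on X are subrings of the ring [X -> R] with pointwise
   operations. [GRing.subring_closed] and [GRing.zmod_closed] are stated for
   boolean predicates, hence the use of [mem]. Ideals need not be proper. *)
Definition ideal_of_subring (A : comPzRingType) (S I : set A) : Prop :=
  [/\ GRing.subring_closed (mem S),
      I `<=` S,
      GRing.zmod_closed (mem I) &
      forall a u, S a -> I u -> I (a * u)].

Section closed_set_ideals.
Variable X : topologicalType.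

Definition ideal_of_closed_sets (P : set (set X)) : Prop :=
  [/\ P !=set0,
      forall A, P A -> closed A,
      forall A B, P A -> P B -> P (A `|` B) &
      forall A B, P A -> B `<=` A -> closed B -> P B].

Definition locally_in (P : set (set X)) : Prop :=
  forall x, exists2 U, open_nbhs x U & P (closure U).

End closed_set_ideals.

Section function_rings.
Variables (R : realType) (X : topologicalType).

Definition zero_set (f : X -> R) : set X := [set x | f x = 0].

Definition cont_funs : set (X -> R) := [set f | continuous f].

Definition bounded_cont_funs : set (X -> R) :=
  [set f | cont_funs f /\ bounded_fun f].

Definition cont_funs_supp (P : set (set X)) : set (X -> R) :=
  [set f | cont_funs f /\ P (closure (~` zero_set f))].

Definition cont_funs_infty (P : set (set X)) : set (X -> R) :=
  [set f | cont_funs f /\ forall e : R, 0 < e -> P [set x | e <= `|f x|]].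

Definition cont_funs_infty_add_bounded (P : set (set X)) : set (X -> R) :=
  [set f + g | f in cont_funs_infty P & g in bounded_cont_funs].

Definition free_ideal (S I : set (X -> R)) : Prop :=
  ideal_of_subring S I /\ \bigcap_(f in I) zero_set f = set0.

End function_rings.

Arguments cont_funs : clear implicits.
Arguments cont_funs_supp R {X} P.
Arguments cont_funs_infty R {X} P.
Arguments cont_funs_infty_add_bounded R {X} P.

(* Main.v *)
(** Complete regularity turns a neighbourhood [U] of [x] with closure in [P]
into a function supported in [closure U] and nonzero at [x], so the functions
with support in [P] have no common zero; they lie in the functions vanishing at
infinity along [P], whose freeness follows. Conversely, if [f] vanishes at
infinity along [P] and [f x != 0], the open set [|f| > |f x| / 2] is a
neighbourhood of [x] whose closure lies in [|f| >= |f x| / 2], a member of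
[P]. *)
Require Import Defs.
From mathcomp Require Import all_boot all_order all_algebra.
From mathcomp Require Import all_classical all_reals all_analysis.
Import Order.TTheory GRing.Theory Num.Theory.
Import numFieldNormedType.Exports.

Set Implicit Arguments.
Unset Strict Implicit.
Unset Printing Implicit Defensive.

Local Open Scope classical_set_scope.
Local Open Scope ring_scope.

Section closed_set_ideals.
Variables (X : topologicalType) (P : set (set X)).
Hypothesis idP : ideal_of_closed_sets P.

Lemma ideal_of_closed_sets_set0 : P set0.
Proof.
have [[A PA] _ _ sub] := idP.
by apply: sub PA _ _ => //; exact: closed0.
Qed.

(** Packages both closure properties of [P] in the form used for sums and products: a set attached
    to [f - g] or [f * g] is covered by one set for [f] and one for [g]. *)
Lemma ideal_of_closed_sets_subU A B C :
  P A -> P B -> closed C -> C `<=` A `|` B -> P C.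
Proof.
have [_ _ PU sub] := idP.
by move=> PA PB cC CAB; apply: sub (PU _ _ PA PB) CAB cC.
Qed.

End closed_set_ideals.

Section function_rings.
Variables (R : realType) (X : topologicalType).
Implicit Types f g : X -> R.

(** * Continuous and bounded continuous functions *)

Lemma cont_funs_cst (c : R) : cont_funs R X (cst c).
Proof. by move=> x; exact: cst_continuous. Qed.

Lemma cont_funsD f g : cont_funs R X f -> cont_funs R X g ->
  cont_funs R X (f + g).
Proof. by move=> cf cg x; apply: (@continuousD R R^o); [exact: cf|exact: cg]. Qed.

Lemma cont_funsB f g : cont_funs R X f -> cont_funs R X g ->
  cont_funs R X (f - g).
Proof. by move=> cf cg x; apply: (@continuousB R R^o); [exact: cf|exact: cg]. Qed.

Lemma cont_funsM f g : cont_funs R X f -> cont_funs R X g ->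
  cont_funs R X (f * g).
Proof. by move=> cf cg x; apply: continuousM; [exact: cf|exact: cg]. Qed.

Lemma cont_funs_norm f : cont_funs R X f -> continuous (fun x => `|f x|).
Proof.
by move=> cf x; apply: (@cvg_norm R R^o); exact: cf.
Qed.

Lemma closed_norm_ge f e : cont_funs R X f -> closed [set x | e <= `|f x|].
Proof.
move=> /cont_funs_norm cf.
by have /continuous_closedP/(_ _ (@closed_ge R e)) := cf.
Qed.

Lemma open_norm_gt f e : cont_funs R X f -> open [set x | e < `|f x|].
Proof.
move=> /cont_funs_norm cf.
by have /continuousP/(_ _ (@open_gt R e)) := cf.
Qed.

Lemma bounded_fun_leP f :
  bounded_fun f <-> exists2 M, 0 < M & forall x, `|f x| <= M.
Proof.
split=> [[M [_ fM]]|[M M0 fM]].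
  (* [bounded_fun] only provides bounds strictly above [M], hence the [+ 1]; the maximum with 0
     makes the bound positive, so that one can divide by it. *)
  exists (Num.max M 0 + 1) => [|x].
    by rewrite ltr_wpDl// le_max lexx orbT.
  by apply: fM => //; rewrite ltr_pwDr// le_max lexx.
exists M; split; first exact: num_real.
by move=> N /ltW MN x _; exact: le_trans (fM x) MN.
Qed.

Lemma bounded_cont_funs_cst (c : R) : bounded_cont_funs (cst c : X -> R).
Proof.
split; first exact: cont_funs_cst.
apply/bounded_fun_leP; exists (`|c| + 1); first by rewrite ltr_wpDl.
by move=> x; rewrite lerDl.
Qed.

Lemma bounded_cont_funsB f g : bounded_cont_funs f -> bounded_cont_funs g ->
  bounded_cont_funs (f - g).
Proof.
move=> [cf /bounded_fun_leP[M M0 fM]] [cg /bounded_fun_leP[N N0 gN]].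
split; first exact: cont_funsB.
apply/bounded_fun_leP; exists (M + N); first exact: addr_gt0.
by move=> x; apply: le_trans (ler_normB _ _) _; exact: lerD.
Qed.

Lemma bounded_cont_funsM f g : bounded_cont_funs f -> bounded_cont_funs g ->
  bounded_cont_funs (f * g).
Proof.
move=> [cf /bounded_fun_leP[M M0 fM]] [cg /bounded_fun_leP[N N0 gN]].
split; first exact: cont_funsM.
apply/bounded_fun_leP; exists (M * N); first exact: mulr_gt0.
by move=> x; rewrite normrM ler_pM.
Qed.

Lemma subring_cont_funs : GRing.subring_closed (mem (cont_funs R X)).
Proof.
split=> [|f g|f g]; rewrite !inE.
- exact: cont_funs_cst.
- exact: cont_funsB.
- exact: cont_funsM.
Qed.

Section ideals.
Variable P : set (set X).
Hypothesis idP : ideal_of_closed_sets P.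

(** * Functions with support in [P] *)

Lemma ideal_cont_funs_supp :
  ideal_of_subring (cont_funs R X) (cont_funs_supp R P).
Proof.
have [_ _ _ sub] := idP.
split; [exact: subring_cont_funs|by move=> f []|split|].
- rewrite inE; split; first exact: cont_funs_cst.
  have -> : ~` zero_set (0 : X -> R) = set0.
    by rewrite -subset0 => x /=; apply.
  by rewrite closure0; exact: ideal_of_closed_sets_set0.
- move=> f g; rewrite !inE => -[cf Pf] [cg Pg]; split; first exact: cont_funsB.
  apply: (ideal_of_closed_sets_subU idP Pf Pg); first exact: closed_closure.
  (* Closure commutes with finite unions, so it suffices that [f - g] vanishes wherever both [f] and
     [g] do. *)
  rewrite -closureU; apply: closureS => x /= fg0.
  have [fx0|] := pselect (f x = 0); last by left.
  by right=> gx0; apply: fg0; rewrite /zero_set /= !fctE fx0 gx0 subr0.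
- move=> a u ca [cu Pu]; split; first exact: cont_funsM.
  apply: (sub _ _ Pu); last exact: closed_closure.
  apply: closureS => x /= au0 u0; apply: au0.
  by rewrite /zero_set /= !fctE u0 mulr0.
Qed.

(** * Functions vanishing at infinity along [P] *)

Lemma cont_funs_infty0 : cont_funs_infty R P 0.
Proof.
split=> [|e e0]; first exact: cont_funs_cst.
have -> : [set x : X | e <= `|(0 : X -> R) x|] = set0.
  by rewrite -subset0 => x /=; rewrite normr0 leNgt e0.
exact: ideal_of_closed_sets_set0.
Qed.

Lemma cont_funs_inftyB f g : cont_funs_infty R P f -> cont_funs_infty R P g ->
  cont_funs_infty R P (f - g).
Proof.
move=> [cf Pf] [cg Pg]; split=> [|e e0]; first exact: cont_funsB.
have e20 : 0 < e / 2 by rewrite divr_gt0.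
apply: (ideal_of_closed_sets_subU idP (Pf _ e20) (Pg _ e20)).
  exact/closed_norm_ge/cont_funsB.
move=> x /= efg; apply/orP; move: efg; apply: contraTT.
rewrite negb_or -!ltNge => /andP[fe ge].
by apply: le_lt_trans (ler_normB _ _) _; rewrite (splitr e) ltrD.
Qed.

Lemma cont_funs_inftyD f g : cont_funs_infty R P f -> cont_funs_infty R P g ->
  cont_funs_infty R P (f + g).
Proof.
move=> If Ig; rewrite -[g]opprK; apply: cont_funs_inftyB => //.
by rewrite -sub0r; apply: cont_funs_inftyB => //; exact: cont_funs_infty0.
Qed.

Lemma cont_funs_inftyM f g : cont_funs_infty R P f -> cont_funs_infty R P g ->
  cont_funs_infty R P (f * g).
Proof.
move=> [cf Pf] [cg Pg]; split=> [|e e0]; first exact: cont_funsM.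
(* Thresholds [e] and 1: where [|f| < e] and [|g| < 1], the product stays below [e]. *)
apply: (ideal_of_closed_sets_subU idP (Pf _ e0) (Pg _ ltr01)).
  exact/closed_norm_ge/cont_funsM.
move=> x /= efg; apply/orP; move: efg; apply: contraTT.
rewrite negb_or -!ltNge fctE normrM => /andP[fe ge].
by rewrite -[e]mulr1 ltr_pM.
Qed.

Lemma cont_funs_infty_bddM f g : bounded_cont_funs f ->
  cont_funs_infty R P g -> cont_funs_infty R P (f * g).
Proof.
have [_ _ _ sub] := idP.
move=> [cf /bounded_fun_leP[M M0 fM]] [cg Pg].
split=> [|e e0]; first exact: cont_funsM.
(* Since [|f| <= M], the inequality [e <= |f * g|] forces [e / M <= |g|]. *)
apply: (sub _ _ (Pg (e / M) _)); first by rewrite divr_gt0.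
  move=> x /= efg; rewrite ler_pdivrMr//.
  by apply: le_trans efg _; rewrite fctE normrM mulrC ler_wpM2l.
exact/closed_norm_ge/cont_funsM.
Qed.

Lemma subring_cont_funs_infty_add_bounded :
  GRing.subring_closed (mem (cont_funs_infty_add_bounded R P)).
Proof.
split=> [|u v|u v]; rewrite !inE.
- exists 0; first exact: cont_funs_infty0.
  by exists 1; [exact: bounded_cont_funs_cst|rewrite add0r].
- move=> [f If [g Bg <-]] [f' If' [g' Bg' <-]].
  exists (f - f'); first exact: cont_funs_inftyB.
  by exists (g - g'); [exact: bounded_cont_funsB|rewrite opprD addrACA].
- move=> [f If [g Bg <-]] [f' If' [g' Bg' <-]].
  (* Expand [(f + g) * (f' + g')]: every term except [g * g'] has a factor vanishing at infinity,
     the other factor being bounded or also vanishing at infinity. *)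
  exists (f * f' + g' * f + g * f').
    by do 2?[apply: cont_funs_inftyD]; [exact: cont_funs_inftyM|
      exact: cont_funs_infty_bddM|exact: cont_funs_infty_bddM].
  exists (g * g'); first exact: bounded_cont_funsM.
  by rewrite mulrDl !mulrDr (mulrC g') !addrA.
Qed.

Lemma ideal_cont_funs_infty :
  ideal_of_subring (cont_funs_infty_add_bounded R P) (cont_funs_infty R P).
Proof.
split; first exact: subring_cont_funs_infty_add_bounded.
- move=> f If; exists f => //.
  by exists 0; [exact: bounded_cont_funs_cst|rewrite addr0].
- split; first by rewrite inE; exact: cont_funs_infty0.
  by move=> f g; rewrite !inE; exact: cont_funs_inftyB.
- move=> _ u [f If [g Bg <-]] Iu; rewrite mulrDl.
  by apply: cont_funs_inftyD; [exact: cont_funs_inftyM|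
    exact: cont_funs_infty_bddM].
Qed.

(** * Inclusion of the two ideals, and the local condition *)

Lemma cont_funs_supp_infty : cont_funs_supp R P `<=` cont_funs_infty R P.
Proof.
have [_ _ _ sub] := idP.
move=> f [cf Pf]; split=> // e e0; apply: (sub _ _ Pf).
  move=> x /= efx; apply: subset_closure => /= fx0.
  by move: efx; rewrite fx0 normr0 leNgt e0.
exact: closed_norm_ge.
Qed.

Lemma locally_in_cont_funs_supp x : completely_regular_space X ->
  locally_in P -> exists2 f, cont_funs_supp R P f & f x <> 0.
Proof.
have [_ _ _ sub] := idP.
move=> crX /(_ x)[U [oU Ux] PU].
have : uniform_separator [set x] (~` U) by apply: crX => //; exact: open_closedC.
move=> /(@uniform_separatorP _ R)[f [cf _ f0 f1]].
have fx : f x = 0 by apply: f0; exists x.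
(* The separating function is 0 at [x] and 1 off [U], so its complement to 1 is nonzero at [x] and
   vanishes off [U]. *)
exists (cst 1 - f); last by rewrite !fctE fx subr0; exact/eqP/oner_neq0.
split; first by apply: cont_funsB => //; exact: cont_funs_cst.
apply: (sub _ _ PU); last exact: closed_closure.
apply: closureS => y /= fy; apply: contrapT => Uy; apply: fy.
have fy1 : f y = 1 by apply: f1; exists y.
by rewrite /zero_set /= !fctE fy1 subrr.
Qed.

Lemma cont_funs_infty_closure_nbhs f x : cont_funs_infty R P f -> f x <> 0 ->
  exists2 U, open_nbhs x U & P (closure U).
Proof.
have [_ _ _ sub] := idP.
move=> [cf Pf] /eqP; rewrite -normr_gt0 => fx0.
exists [set y | `|f x| / 2 < `|f y|].
  split; first exact: open_norm_gt.
  by rewrite /= ltr_pdivrMr// ltr_pMr// ltr1n.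
apply: (sub _ _ (Pf (`|f x| / 2) _)); first by rewrite divr_gt0.
  2: exact: closed_closure.
(* Writing the closed set as its own closure reduces the inclusion to the passage from strict to
   large inequality. *)
have /closure_id -> := closed_norm_ge (e := `|f x| / 2) cf.
by apply: closureS => y /= /ltW.
Qed.

End ideals.

(** Pointwise form of freeness, which lets each implication of the theorem be checked at one point
    with one function. *)
Lemma bigcap_zero_set_eq0P (I : set (X -> R)) :
  \bigcap_(f in I) zero_set f = set0 <->
  forall x, exists2 f, I f & f x <> 0.
Proof.
split=> [I0 x|I0].
  have : ~ (\bigcap_(f in I) zero_set f) x by rewrite I0.
  by move=> /existsNP[f /not_implyP[If fx]]; exists f.
by rewrite -subset0 => x /= Ix; have [f If] := I0 x; apply; exact: Ix.
Qed.

End function_rings.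

Theorem theorem4p1 (R : realType) (X : topologicalType) (P : set (set X))
    (crX : completely_regular_space X) (hX : hausdorff_space X)
    (idP : ideal_of_closed_sets P) :
  [<-> locally_in P;
       free_ideal (cont_funs R X) (cont_funs_supp R P);
       free_ideal (cont_funs_infty_add_bounded R P) (cont_funs_infty R P)].
Proof.
tfae.
- move=> lP; split; first exact: ideal_cont_funs_supp.
  apply/bigcap_zero_set_eq0P => x; exact: locally_in_cont_funs_supp.
(* Freeness passes to the larger family, since enlarging a family can only shrink its set of common
   zeros. *)
- move=> [_ /bigcap_zero_set_eq0P fr]; split; first exact: ideal_cont_funs_infty.
  apply/bigcap_zero_set_eq0P => x; have [f If fx] := fr x.
  by exists f => //; exact: cont_funs_supp_infty.
- move=> [_ /bigcap_zero_set_eq0P fr] x; have [f If fx] := fr x.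
  exact: cont_funs_infty_closure_nbhs If fx.
Qed.
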